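(* Let $\mathbf{k}$ be a field of characteristic $0$, $n,p\ge1$ integers, and $f=(f_1,\dots,f_p)\in\mathbf{k}[x]^p$ with $x=(x_1,\dots,x_n)$; put $F=f_1\cdots f_p$. Let $I_2\subset\mathbf{k}[x,s]$ be the ideal defined in the context and let $I_2=\Upsilon_1\cap\cdots\cap\Upsilon_r$ be a primary decomposition of $I_2$ in $\mathbf{k}[x,s]$. For each subset $\sigma\subset\{1,\dots,r\}$ let - $W_\sigma=\mathbf{k}^n\setminus\bigl(\bigcup_{i=1}^r V(\Upsilon_i\cap\mathbf{k}[x])\bigr)$ if $\sigma=\emptyset$; - $W_\sigma=\bigcap_{i=1}^r V(\Upsilon_i\cap\mathbf{k}[x])$ if $\sigma=\{1,\dots,r\}$; - $W_\sigma=\bigl(\bigcap_{i\in\sigma}V(\Upsilon_i\cap\mathbf{k}[x])\bigr)\setminus\bigl(\bigcup_{i\notin\sigma}V(\Upsilon_i\cap\mathbf{k}[x])\bigr)$ otherwise. Then $\bigcup_\sigma W_\sigma$ is a constructible stratification of $\mathbf{k}^n$ (that is, the $W_\sigma$ are finitely many pairwise disjoint, possibly empty, constructible subsets with union $\mathbf{k}^n$) such that the map $\mathbf{k}^n\ni a\mapsto\mathcal{B}_{loc,a}(f)$ is constant on each $W_\sigma$.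
   Context: For an ideal $K\subset\mathbf{k}[x]$, $V(K)\subset\mathbf{k}^n$ denotes its zero set. ''Ideal'' in a noncommutative ring means left ideal. For $A$ equal to $\mathbf{k}[x]$ or to the localization $\mathbf{k}[x]_a$ of $\mathbf{k}[x]$ at a point $a\in\mathbf{k}^n$ (fractions whose denominators do not vanish at $a$), let $D_A=A\langle\partial_{x_1},\dots,\partial_{x_n}\rangle$ be the ring of differential operators with coefficients in $A$, and $D=D_{\mathbf{k}[x]}$. Let $s=(s_1,\dots,s_p)$ be indeterminates and let $\mathcal{L}_A=A[1/F,s]\cdot f^s$ be the free rank-one $A[1/F,s]$-module on the symbol $f^s=f_1^{s_1}\cdots f_p^{s_p}$. It is a $D_A[s]$-module via $\partial_{x_i}\cdot g f^s=\bigl(\frac{\partial g}{\partial x_i}+g\sum_{j=1}^p s_j\frac{\partial f_j}{\partial x_i}f_j^{-1}\bigr)f^s$ for $g\in A[1/F,s]$. The local Bernstein-Sato ideal of $f$ at $a$ is $\mathcal{B}_{loc,a}(f)=\{b(s)\in\mathbf{k}[s] : b(s)f^s\in D_{\mathbf{k}[x]_a}[s]\cdot Ff^s\}$. Let $I_1=\mathrm{ann}_{D[s]}(f^s)$ be the annihilator of $f^s$ in $D[s]$, and $I_2=(I_1+D[s]\cdot F)\cap\mathbf{k}[x,s]$. *)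

(* Defs.v *)
From HB Require Import structures.
From mathcomp Require Import all_boot all_order all_algebra.
From mathcomp Require Import boolp classical_sets.
From mathcomp Require Import mpoly ring.

Set Implicit Arguments.
Unset Strict Implicit.
Unset Printing Implicit Defensive.

Import GRing.Theory.
Local Open Scope ring_scope.
Local Open Scope classical_set_scope.

Definition is_ideal (R : comNzRingType) (I : set R) : Prop :=
  [/\ I 0, (forall x y, I x -> I y -> I (x + y)) &
      (forall a x, I x -> I (a * x))].

Definition is_primary (R : comNzRingType) (I : set R) : Prop :=
  [/\ is_ideal I, ~ I 1 &
      forall x y, I (x * y) -> I x \/ exists m : nat, I (y ^+ m)].

Definition primary_decomposition (R : comNzRingType) (I : set R)
    (r : nat) (U : 'I_r -> set R) : Prop :=
  (forall i, is_primary (U i)) /\ I = \bigcap_i U i.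

Definition zero_set (k : fieldType) (n : nat) (J : set {mpoly k[n]}) :
    set ('I_n -> k) :=
  [set a | forall g, J g -> g.@[a] = 0].

Definition zariski_closed (k : fieldType) (n : nat) (Z : set ('I_n -> k)) :
    Prop :=
  exists2 J : set {mpoly k[n]}, is_ideal J & Z = zero_set J.

(* A finite union of locally closed sets. *)
Definition constructible (k : fieldType) (n : nat) (S : set ('I_n -> k)) :
    Prop :=
  exists (m : nat) (Z Z' : 'I_m -> set ('I_n -> k)),
    [/\ (forall i, zariski_closed (Z i)), (forall i, zariski_closed (Z' i)) &
        S = \bigcup_i (Z i `\` Z' i)].

Definition constructible_stratification (k : fieldType) (n : nat) (T : finType)
    (W : T -> set ('I_n -> k)) : Prop :=
  [/\ forall t, constructible (W t),
      forall t t', t != t' -> W t `&` W t' = set0 &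
      \bigcup_t W t = setT].

(* Both [k[x]] and its localizations at points are subrings of [k(x)], so all
   operators are handled inside [D_{k(x)}[s]]; the coefficient ring [A] occurs
   as a subset of [k(x)].  The polynomial ring [k[x,s]] is [k[x][s]]. *)
Notation xpoly k n := {mpoly k[n]} (only parsing).
Notation xfrac k n := {fraction {mpoly k[n]}} (only parsing).
Notation xspoly k n p := {mpoly {mpoly k[n]}[p]} (only parsing).
Notation xsfrac k n p := {mpoly {fraction {mpoly k[n]}}[p]} (only parsing).

(* [\sum_b c_b(x,s) d^b], with coefficients written on the left, is the
   polynomial in the [d_i] with coefficients [c_b]; only the additive structure
   and the scaling of this type are those of operators: the product is [dmul]. *)
Notation diffop k n p :=
  {mpoly {mpoly {fraction {mpoly k[n]}}[p]}[n]} (only parsing).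

Notation "x %:F" := (@FracField.tofrac _ x) : ring_scope.

(* The quotient rule on a representative; see [fderivE] for independence.
   Locked (as is [sderiv]), since unfolding [repr] makes conversion diverge. *)
HB.lock Definition fderiv (k : fieldType) (n : nat) (i : 'I_n) (u : xfrac k n) :
    xfrac k n :=
  let g := \n_(repr u) in let h := \d_(repr u) in
  (g^`M(i) * h - g * h^`M(i))%:F / (h ^+ 2)%:F.

Lemma frac_repr (R : idomainType) (u : {fraction R}) :
  u = (\n_(repr u))%:F / (\d_(repr u))%:F.
Proof.
have d0 := denom_ratioP (repr u).
apply: (mulIf (x := (\d_(repr u))%:F)); first by rewrite tofrac_eq0.
rewrite divfK ?tofrac_eq0 // -{1}[u]reprK.
unlock FracField.tofrac; rewrite -[LHS]FracField.pi_mul.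
apply/eqmodP; rewrite /= FracField.equivfE /FracField.mulf.
by rewrite !numden_Ratio ?mulf_neq0 ?oner_eq0 // !mulr1 mulrC.
Qed.

Lemma fderivE (k : fieldType) (n : nat) (i : 'I_n) (g h : xpoly k n) :
  h != 0 ->
  fderiv i (g%:F / h%:F) = (g^`M(i) * h - g * h^`M(i))%:F / (h ^+ 2)%:F.
Proof.
move=> h0; rewrite fderiv.unlock; set u := g%:F / h%:F.
have d0 := denom_ratioP (repr u); have := frac_repr u.
move: (\n_(repr u)) (\d_(repr u)) d0 => g' h' h'0.
rewrite /u => /eqP; rewrite eqr_div ?tofrac_eq0 // -!tofracM tofrac_eq => /eqP E.
apply/eqP; rewrite eqr_div ?tofrac_eq0 ?expf_neq0 // -!tofracM tofrac_eq.
apply/eqP; have /(congr1 (mderiv i)) := E; rewrite !mderivM => E'.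
have -> : (g'^`M(i) * h' - g' * h'^`M(i)) * h ^+ 2
   = h * h' * (g'^`M(i) * h + g' * h^`M(i)) - (g' * h) * (h'^`M(i) * h + h' * h^`M(i)).
  by ring.
by rewrite -E' -E; ring.
Qed.

HB.lock Definition sderiv (k : fieldType) (n p : nat) (i : 'I_n) (u : xsfrac k n p) :
    xsfrac k n p :=
  map_mpoly (fderiv i) u.

(* [P u] for an operator [P] with coefficients in [R], when each [d_i] acts on
   the module [M] by [nabla i] (the [nabla i] commute in the instances below). *)
Definition dapply (R : comNzRingType) (n : nat) (M : lmodType R)
    (nabla : 'I_n -> M -> M) (P : {mpoly R[n]}) (u : M) : M :=
  \sum_(b <- msupp P)
    P@_b *: foldr (fun i => iter (b i) (nabla i)) u (enum 'I_n).

(* The product of operators, determined by [d_i c = c d_i + der i c]. *)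
Definition dmul (R : comNzRingType) (n : nat) (der : 'I_n -> R -> R)
    (P Q : {mpoly R[n]}) : {mpoly R[n]} :=
  dapply (fun i (T : {mpoly R[n]}) => T * 'X_i + map_mpoly (der i) T) P Q.

Definition dop_over (k : fieldType) (n p : nat) (A : set (xfrac k n))
    (P : diffop k n p) : Prop :=
  forall b c, A (P@_b)@_c.

Definition xpoly_sub (k : fieldType) (n : nat) : set (xfrac k n) :=
  [set u | exists g : xpoly k n, u = g%:F].

Definition local_sub (k : fieldType) (n : nat) (a : 'I_n -> k) :
    set (xfrac k n) :=
  [set u | exists g h : xpoly k n, h.@[a] != 0 /\ u = g%:F / h%:F].

Definition Fprod (k : fieldType) (n p : nat) (f : 'I_p -> xpoly k n) :
    xpoly k n :=
  \prod_j f j.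

(* An element [u] of [k(x)[s]] stands for [u f^s]; when [F != 0], the module
   [A[1/F,s] f^s] consists of the [u] with coefficients in [A[1/F]], and is stable
   under the operators with coefficients in [A[s]]. *)
Definition fs_nabla (k : fieldType) (n p : nat) (f : 'I_p -> xpoly k n)
    (i : 'I_n) (u : xsfrac k n p) : xsfrac k n p :=
  sderiv i u
  + u * \sum_(j < p) 'X_j * (((f j)^`M(i))%:F / (f j)%:F)%:MP.

Definition fs_act (k : fieldType) (n p : nat) (f : 'I_p -> xpoly k n)
    (P : diffop k n p) (u : xsfrac k n p) : xsfrac k n p :=
  dapply (M := (xsfrac k n p)^o) (fs_nabla f) P u.

(* Equality in [A[1/F,s] f^s], for any [A]: elements of the localization agree
   when a power of [F] kills their difference.  If [F != 0] this is [u = v]; if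
   [F = 0] the module is zero, and the value [1 / 0 = 0] used in [fs_nabla] is
   irrelevant. *)
Definition fs_eq (k : fieldType) (n p : nat) (f : 'I_p -> xpoly k n)
    (u v : xsfrac k n p) : Prop :=
  exists m : nat, (Fprod f ^+ m)%:F *: u = (Fprod f ^+ m)%:F *: v.

Definition local_BS (k : fieldType) (n p : nat) (f : 'I_p -> xpoly k n)
    (a : 'I_n -> k) : set {mpoly k[p]} :=
  [set b | exists2 P : diffop k n p, dop_over (local_sub a) P &
     fs_eq f (map_mpoly (fun c : k => (c%:MP_[n])%:F) b)
             (fs_act f P ((Fprod f)%:F)%:MP)].

Definition I1 (k : fieldType) (n p : nat) (f : 'I_p -> xpoly k n) :
    set (diffop k n p) :=
  [set P | dop_over (@xpoly_sub k n) P /\ fs_eq f (fs_act f P 1) 0].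

Definition I2 (k : fieldType) (n p : nat) (f : 'I_p -> xpoly k n) :
    set (xspoly k n p) :=
  [set h | exists P Q : diffop k n p,
     [/\ I1 f P, dop_over (@xpoly_sub k n) Q &
         (map_mpoly (@FracField.tofrac (xpoly k n)) h)%:MP
           = P + dmul (@sderiv k n p) Q (((Fprod f)%:F)%:MP)%:MP]].

Definition contract_x (k : fieldType) (n p : nat) (I : set (xspoly k n p)) :
    set (xpoly k n) :=
  [set g | I g%:MP].

(* An empty intersection is [k^n] and an empty union is empty, so this formula
   also covers [sigma] empty and [sigma] full. *)
Definition stratum (k : fieldType) (n p r : nat)
    (U : 'I_r -> set (xspoly k n p)) (sigma : {set 'I_r}) : set ('I_n -> k) :=
  (\bigcap_(i in [set i | i \in sigma]) zero_set (contract_x (U i)))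
  `\` (\bigcup_(i in [set i | i \notin sigma]) zero_set (contract_x (U i))).

(* Main.v *)
(** Clearing the denominators of a local operator [P] with [b f^s = P F f^s]
    gives [h] with [h(a) <> 0] and [h b] in [I2]; conversely [h b = P + Q F] with
    [P] killing [f^s] gives [b f^s = (h^-1 Q) F f^s].  So [b] is in the local ideal
    at [a] iff [h b] is in [I2] for some such [h], and by primariness this holds
    iff [b] is in every component [Upsilon_i] whose contraction to [k[x]] vanishes
    at [a].  The stratum of [a] records exactly which components these are. *)
From HB Require Import structures.
Require Import Defs.
From mathcomp Require Import all_boot all_order all_algebra.
From mathcomp Require Import boolp classical_sets.
From mathcomp Require Import mpoly ring.

Set Implicit Arguments.
Unset Strict Implicit.
Unset Printing Implicit Defensive.

Import GRing.Theory.
Local Open Scope ring_scope.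
Local Open Scope classical_set_scope.

(** * Additive maps and derivations applied coefficientwise to polynomials *)

Section CoefficientwiseMap.
Variables (R S : comNzRingType) (n : nat) (d : R -> S).
Hypothesis dB : zmod_morphism d.

Lemma mcoeff_map_zmod (P : {mpoly R[n]}) m : (map_mpoly d P)@_m = d P@_m.
Proof.
pose Md := GRing.isZmodMorphism.Build R S d dB.
pose D : {additive R -> S} := HB.pack d Md.
exact: (mcoeff_map_mpoly D).
Qed.

Lemma map_mpoly_zmod : zmod_morphism (map_mpoly (n := n) d).
Proof. by move=> P Q; apply/mpolyP=> m; rewrite mcoeffB !mcoeff_map_zmod mcoeffB dB. Qed.

End CoefficientwiseMap.

Section ZmodMorphism.
Variables (U V : zmodType) (d : U -> V).
Hypothesis dB : zmod_morphism d.

Lemma zmod_morphism0 : d 0 = 0.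
Proof. by rewrite -[0](subrr 0) dB subrr. Qed.

Lemma zmod_morphismD x y : d (x + y) = d x + d y.
Proof. by rewrite -{1}[y]opprK dB -[- y]sub0r dB zmod_morphism0 sub0r opprK. Qed.

Lemma zmod_morphism_sum I (s : seq I) (P : pred I) (G : I -> U) :
  d (\sum_(i <- s | P i) G i) = \sum_(i <- s | P i) d (G i).
Proof. by elim/big_rec2: _ => [|i x y _ <-]; rewrite (zmod_morphism0, zmod_morphismD). Qed.

End ZmodMorphism.

Section CoefficientwiseDerivation.
Variables (R : comNzRingType) (n : nat) (d : R -> R).
Hypothesis dB : zmod_morphism d.
Hypothesis dM : forall x y, d (x * y) = d x * y + x * d y.

(** Each coefficient of a product is a convolution sum, to which the Leibniz rule of [d] applies
    term by term. *)
Lemma map_mpoly_leibniz (P Q : {mpoly R[n]}) :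
  map_mpoly d (P * Q) = map_mpoly d P * Q + P * map_mpoly d Q.
Proof.
apply/mpolyP=> m; rewrite mcoeff_map_zmod // mcoeffD !mcoeffM.
rewrite (zmod_morphism_sum dB) -big_split /=; apply: eq_bigr => b _.
by rewrite dM !mcoeff_map_zmod.
Qed.

End CoefficientwiseDerivation.

(** * Differential operators acting on a module, and composition of operators *)

Section Apply.
Variables (R : comNzRingType) (n : nat) (M : lmodType R).
Variable nabla : 'I_n -> M -> M.
Implicit Types (P Q : {mpoly R[n]}) (b : 'X_{1..n}) (u : M).

Definition dmonom (b : 'X_{1..n}) (u : M) : M :=
  foldr (fun i => iter (b i) (nabla i)) u (enum 'I_n).

(** Padding the support with zero coefficients changes nothing, so operators with different supports
    can be compared over one common list. *)
Lemma dapply_seq P u (s : seq 'X_{1..n}) :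
  uniq s -> {subset msupp P <= s} ->
  dapply nabla P u = \sum_(b <- s) P@_b *: dmonom b u.
Proof.
move=> us sub; rewrite [RHS](bigID (fun b => b \in msupp P)) /=.
rewrite [X in _ + X]big1 ?addr0 => [|b /memN_msupp_eq0 ->]; last by rewrite scale0r.
rewrite -big_filter; apply: perm_big; apply: uniq_perm.
- exact: msupp_uniq.
- exact: filter_uniq.
by move=> b; rewrite mem_filter; case bP: (b \in msupp P) => //=; rewrite sub.
Qed.

Lemma dapply_lin c P Q u :
  dapply nabla (c *: P + Q) u = c *: dapply nabla P u + dapply nabla Q u.
Proof.
pose s := undup (msupp P ++ msupp Q ++ msupp (c *: P + Q)).
have us : uniq s by exact: undup_uniq.
rewrite !(dapply_seq _ us); first last.
- by move=> b bP; rewrite mem_undup !mem_cat bP !orbT.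
- by move=> b bP; rewrite mem_undup !mem_cat bP.
- by move=> b bP; rewrite mem_undup !mem_cat bP !orbT.
rewrite scaler_sumr -big_split /=; apply: eq_bigr => b _.
by rewrite mcoeffD mcoeffZ scalerDl scalerA.
Qed.

Lemma dapply0 u : dapply nabla 0 u = 0.
Proof. by rewrite /dapply msupp0 big_nil. Qed.

Lemma dapplyD P Q u :
  dapply nabla (P + Q) u = dapply nabla P u + dapply nabla Q u.
Proof. by rewrite -{1}[P]scale1r dapply_lin scale1r. Qed.

Lemma dapplyZ c P u : dapply nabla (c *: P) u = c *: dapply nabla P u.
Proof. by rewrite -[c *: P]addr0 dapply_lin dapply0 addr0. Qed.

Lemma dapplyB P Q u :
  dapply nabla (P - Q) u = dapply nabla P u - dapply nabla Q u.
Proof. by rewrite -[- Q]scaleN1r dapplyD dapplyZ scaleN1r. Qed.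

Lemma dapplyX b u : dapply nabla 'X_[b] u = dmonom b u.
Proof. by rewrite /dapply msuppX big_seq1 mcoeffX eqxx scale1r. Qed.

Lemma dapplyC c u : dapply nabla c%:MP u = c *: u.
Proof.
have -> : c%:MP = c *: 'X_[0] :> {mpoly R[n]} by rewrite -mul_mpolyC mpolyX0 mulr1.
rewrite dapplyZ dapplyX /dmonom.
by congr (_ *: _); elim: (enum _) => //= i s ->; rewrite mnm0E.
Qed.

Lemma dapply_sum I (s : seq I) (G : I -> {mpoly R[n]}) u :
  dapply nabla (\sum_(i <- s) G i) u = \sum_(i <- s) dapply nabla (G i) u.
Proof. by elim/big_rec2: _ => [|i P v _ <-]; rewrite (dapply0, dapplyD). Qed.

Variable der : 'I_n -> R -> R.
Hypothesis derB : forall i, zmod_morphism (der i).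
Hypothesis nablaB : forall i, zmod_morphism (nabla i).
Hypothesis nablaZ : forall i c u, nabla i (c *: u) = der i c *: u + c *: nabla i u.
Hypothesis nablaC : forall i j u, nabla i (nabla j u) = nabla j (nabla i u).

(** The extra [nabla i] sits in the middle of the composite and is moved outermost by
    commutation. *)
Lemma dmonomU i b u : dmonom (b + U_(i))%MM u = nabla i (dmonom b u).
Proof.
have iterC j m v : iter m (nabla j) (nabla i v) = nabla i (iter m (nabla j) v).
  by elim: m => //= m ->; rewrite nablaC.
(* Generalized from [enum 'I_n] to duplicate-free lists for the induction; [i] then contributes at
   most one extra factor. *)
have H s : uniq s -> foldr (fun j => iter ((b + U_(i))%MM j) (nabla j)) u s =
   (if i \in s then nabla i else id) (foldr (fun j => iter (b j) (nabla j)) u s).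
  elim: s => //= j s IH /andP[js us]; rewrite IH // in_cons mnmDE mnm1E.
  case: (eqVneq i j) => [ij|ij] /=.
    by rewrite -ij in js *; rewrite (negbTE js) addn1.
  by rewrite addn0; case: (i \in s) => //=; rewrite iterC.
by rewrite /dmonom H ?enum_uniq // mem_enum.
Qed.

(* [P * 'X_i + map_mpoly (der i) P] is the product of operators [d_i P]. *)
Lemma dapply_mulX i P u :
  dapply nabla (P * 'X_i + map_mpoly (der i) P) u = nabla i (dapply nabla P u).
Proof.
have dapplyMX : dapply nabla (P * 'X_i) u =
    \sum_(b <- msupp P) P@_b *: nabla i (dmonom b u).
  rewrite {1}[P]mpolyE mulr_suml dapply_sum; apply: eq_bigr => b _.
  by rewrite -scalerAl -mpolyXD dapplyZ dapplyX dmonomU.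
have dapplyd : dapply nabla (map_mpoly (der i) P) u =
    \sum_(b <- msupp P) der i P@_b *: dmonom b u.
  rewrite (@dapply_seq _ u (msupp P)) ?msupp_uniq //.
    by apply: eq_bigr => b _; rewrite mcoeff_map_zmod.
  move=> b; rewrite !mcoeff_msupp mcoeff_map_zmod //.
  by apply: contraNneq => ->; rewrite (zmod_morphism0 (derB i)).
rewrite dapplyD dapplyMX dapplyd addrC -big_split /=.
rewrite [dapply _ _ _]/dapply (zmod_morphism_sum (nablaB i)).
by apply: eq_bigr => b _; rewrite nablaZ.
Qed.

(** [dmul] is itself [dapply] for left multiplication by the [d_i] on operators, and [dapply_mulX]
    turns each such multiplication into [nabla i]. *)
Lemma dapply_dmul P Q u :
  dapply nabla (dmul der P Q) u = dapply nabla P (dapply nabla Q u).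
Proof.
rewrite /dmul [X in dapply nabla X u]/dapply dapply_sum [RHS]/dapply.
apply: eq_bigr => b _.
rewrite dapplyZ; congr (_ *: _); elim: (enum _) => //= i s <-.
by elim: (b i) => //= m <-; rewrite dapply_mulX.
Qed.

End Apply.

(** * Extension of commuting derivations from a domain to its field of fractions *)

Section QuotientRule.
Variables (K : fieldType) (a a' b b' c c' d d' : K).
Hypotheses (b0 : b != 0) (d0 : d != 0).

(** Primed letters stand for the derivatives of the unprimed ones; the left side is the quotient
    rule for [(a d - c b) / (b d)]. *)
Lemma quotient_ruleB :
  ((a' * d + a * d' - (c' * b + c * b')) * (b * d) - (a * d - c * b) * (b' * d + b * d'))
    / (b * d) ^+ 2
  = (a' * b - a * b') / b ^+ 2 - (c' * d - c * d') / d ^+ 2.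
Proof. by field; rewrite b0 d0. Qed.

Lemma quotient_ruleM :
  ((a' * c + a * c') * (b * d) - (a * c) * (b' * d + b * d')) / (b * d) ^+ 2
  = (a' * b - a * b') / b ^+ 2 * (c / d) + a / b * ((c' * d - c * d') / d ^+ 2).
Proof. by field; rewrite b0 d0. Qed.

End QuotientRule.

(* Kept over an abstract field of fractions: on [{fraction _}] itself, rewriting
   with the ring lemmas makes conversion diverge. *)
Section FractionDerivation.
Variables (R : idomainType) (K : fieldType) (phi : {rmorphism R -> K}) (I : Type).
Variables (der : I -> R -> R) (D : I -> K -> K).
Hypothesis phi_eq0 : forall h : R, (phi h == 0) = (h == 0).
Hypothesis fracP : forall u, exists g h : R, h != 0 /\ u = phi g / phi h.
Hypothesis derB : forall i, zmod_morphism (der i).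
Hypothesis derM : forall i g h, der i (g * h) = der i g * h + g * der i h.
Hypothesis derC : forall i j g, der i (der j g) = der j (der i g).
Hypothesis DE : forall i (g h : R), h != 0 ->
  D i (phi g / phi h) = phi (der i g * h - g * der i h) / phi (h ^+ 2).

Lemma frac_derB i : zmod_morphism (D i).
Proof.
move=> u v; have [a [b [b0 ->]]] := fracP u; have [c [d [d0 ->]]] := fracP v.
have bF : phi b != 0 by rewrite phi_eq0.
have dF : phi d != 0 by rewrite phi_eq0.
have -> : phi a / phi b - phi c / phi d = phi (a * d - c * b) / phi (b * d).
  by rewrite rmorphB !rmorphM /=; field; rewrite bF dF.
rewrite !DE ?mulf_neq0 // derB !derM !(rmorphB, rmorphXn, rmorphM, rmorphD) /=.
exact: quotient_ruleB.
Qed.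

Lemma frac_derM i u v : D i (u * v) = D i u * v + u * D i v.
Proof.
have [a [b [b0 ->]]] := fracP u; have [c [d [d0 ->]]] := fracP v.
have bF : phi b != 0 by rewrite phi_eq0.
have dF : phi d != 0 by rewrite phi_eq0.
have -> : phi a / phi b * (phi c / phi d) = phi (a * c) / phi (b * d).
  by rewrite mulf_div -!rmorphM.
rewrite !DE ?mulf_neq0 // !derM !(rmorphB, rmorphXn, rmorphM, rmorphD) /=.
exact: quotient_ruleM.
Qed.

Lemma frac_der_phi i g : D i (phi g) = phi (der i g).
Proof.
have d1 : der i 1 = 0.
  by apply: (addrI (der i 1)); rewrite addr0 -{3}[1]mulr1 derM mulr1 mul1r.
rewrite -[phi g]divr1 -(rmorph1 phi) DE ?oner_eq0 // d1.
by rewrite mulr0 subr0 mulr1 expr1n rmorph1 divr1.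
Qed.

(** Solve the product rule for [u = (u / phi h) * phi h]. Unlike [DE], it allows any fraction as
    numerator, as second derivatives require. *)
Lemma frac_derV i u (h : R) : h != 0 ->
  D i (u / phi h) = (D i u - u / phi h * phi (der i h)) / phi h.
Proof.
move=> h0; have hF : phi h != 0 by rewrite phi_eq0.
apply: (mulIf hF); rewrite divfK // -frac_der_phi.
by have := frac_derM i (u / phi h) (phi h); rewrite divfK // => ->; rewrite addrK.
Qed.

Lemma frac_derC i j u : D i (D j u) = D j (D i u).
Proof.
have [g [h [h0 ->]]] := fracP u; have hF : phi h != 0 by rewrite phi_eq0.
rewrite !(frac_derV, frac_der_phi) // !(frac_derB, frac_derM, frac_derV, frac_der_phi) //.
(* Once the mixed second derivatives of [g] and [h] are put in the same order, only a field identity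
   is left. *)
rewrite [der i (der j g)]derC [der i (der j h)]derC.
by field; rewrite hF.
Qed.

End FractionDerivation.

Section FracDerivation.
Variables (k : fieldType) (n : nat).
Implicit Types (g h : {mpoly k[n]}) (u v : {fraction {mpoly k[n]}}).

Lemma fracP u : exists g h : {mpoly k[n]}, h != 0 /\ u = g%:F / h%:F.
Proof.
exists (\n_(repr u)), (\d_(repr u)).
by split; [exact: denom_ratioP | exact: frac_repr].
Qed.

Lemma fderivB i : zmod_morphism (@fderiv k n i).
Proof.
exact: (frac_derB (@tofrac_eq0 _) fracP (@mderivB n k) (@mderivM n k) (@fderivE k n)).
Qed.

Lemma fderivM i u v : fderiv i (u * v) = fderiv i u * v + u * fderiv i v.
Proof. exact: (frac_derM (@tofrac_eq0 _) fracP (@mderivM n k) (@fderivE k n)). Qed.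

Lemma fderiv_tofrac i g : fderiv i g%:F = (g^`M(i))%:F.
Proof. exact: (frac_der_phi (@mderivM n k) (@fderivE k n)). Qed.

Lemma fderivC i j u : fderiv i (fderiv j u) = fderiv j (fderiv i u).
Proof.
apply: (@frac_derC _ _ (@FracField.tofrac {mpoly k[n]}) _ (@mderiv n k) (@fderiv k n)).
- exact: tofrac_eq0.
- exact: fracP.
- exact: mderivB.
- exact: mderivM.
- by move=> i1 i2 g; exact: mderiv_comm.
- exact: fderivE.
Qed.

End FracDerivation.

(** * Flatness of the connection defining the action on [f^s] *)

Section Connection.
Variables (R : comNzRingType) (I : Type) (d : I -> R -> R) (L : I -> R).
Hypothesis dB : forall i, zmod_morphism (d i).
Hypothesis dM : forall i x y, d i (x * y) = d i x * y + x * d i y.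
Hypothesis dC : forall i j x, d i (d j x) = d j (d i x).
Hypothesis LC : forall i j, d i (L j) = d j (L i).
Let nabla i u := d i u + u * L i.

Lemma connectionB i : zmod_morphism (nabla i).
Proof. by move=> x y; rewrite /nabla dB; ring. Qed.

Lemma connectionM i c u : nabla i (c * u) = d i c * u + c * nabla i u.
Proof. by rewrite /nabla dM; ring. Qed.

(** The commutator of [nabla i] and [nabla j] is multiplication by [d i (L j) - d j (L i)], which
    [LC] makes zero. *)
Lemma connectionC i j u : nabla i (nabla j u) = nabla j (nabla i u).
Proof.
have dD k := zmod_morphismD (dB k).
by rewrite /nabla !dD !dM dC LC; ring.
Qed.

End Connection.

Section LogConnection.
Variables (k : fieldType) (n p : nat) (f : 'I_p -> {mpoly k[n]}).
Implicit Types (u v : {mpoly {fraction {mpoly k[n]}}[p]}).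

Lemma sderivB i : zmod_morphism (@sderiv k n p i).
Proof. by rewrite sderiv.unlock; exact: map_mpoly_zmod (@fderivB k n i). Qed.

Lemma sderivM i u v : sderiv i (u * v) = sderiv i u * v + u * sderiv i v.
Proof.
by rewrite sderiv.unlock; exact: (map_mpoly_leibniz (@fderivB k n i) (@fderivM k n i)).
Qed.

Lemma mcoeff_sderiv i u m : (sderiv i u)@_m = fderiv i u@_m.
Proof. by rewrite sderiv.unlock; exact: (mcoeff_map_zmod (@fderivB k n i)). Qed.

Lemma sderivC i j u : sderiv i (sderiv j u) = sderiv j (sderiv i u).
Proof. by apply/mpolyP => m; rewrite !mcoeff_sderiv fderivC. Qed.

(** The form [dg/g] is closed: in the quotient rule both sides have the numerator formed from the
    mixed second derivative and the product of the two first derivatives. *)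
Lemma fderiv_logC i j (g : {mpoly k[n]}) :
  fderiv i ((g^`M(j))%:F / g%:F) = fderiv j ((g^`M(i))%:F / g%:F).
Proof.
have [->|g0] := eqVneq g 0.
  by rewrite !mderiv0 tofrac0 !mul0r !(zmod_morphism0 (@fderivB _ _ _)).
rewrite !fderivE // mderiv_comm; congr (_%:F / _).
by rewrite [g^`M(j) * _]mulrC.
Qed.

(** The [i]-th component of the logarithmic differential of [f^s], with ['X_j] in the role of
    [s_j]. *)
Definition log_form (i : 'I_n) : {mpoly {fraction {mpoly k[n]}}[p]} :=
  \sum_(j < p) 'X_j * (((f j)^`M(i))%:F / (f j)%:F)%:MP.

(** [sderiv] differentiates coefficients only and treats each [s_j] as a constant, so closedness
    reduces to that of each [df_j/f_j]. *)
Lemma log_form_closed i j : sderiv i (log_form j) = sderiv j (log_form i).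
Proof.
rewrite /log_form !(zmod_morphism_sum (@sderivB _)); apply: eq_bigr => l _.
apply/mpolyP => m; rewrite !mcoeff_sderiv ![_ * _%:MP]mulrC !mcoeffCM !mcoeffX.
by case: (_ == m); rewrite ?mulr1 ?mulr0 ?(zmod_morphism0 (@fderivB _ _ _)) // fderiv_logC.
Qed.

Lemma fs_nablaB i : zmod_morphism (fs_nabla f i).
Proof. exact: (connectionB log_form sderivB). Qed.

Lemma fs_nablaM i c u : fs_nabla f i (c * u) = sderiv i c * u + c * fs_nabla f i u.
Proof. exact: (connectionM log_form sderivM). Qed.

Lemma fs_nablaC i j u : fs_nabla f i (fs_nabla f j u) = fs_nabla f j (fs_nabla f i u).
Proof. exact: (connectionC sderivB sderivM sderivC log_form_closed). Qed.

Lemma fs_act_dmul (P Q : diffop k n p) u :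
  fs_act f (dmul (@sderiv k n p) P Q) u = fs_act f P (fs_act f Q u).
Proof. apply: (@dapply_dmul _ n (xsfrac k n p)^o (fs_nabla f) (@sderiv k n p)).
- exact: sderivB.
- exact: fs_nablaB.
- exact: fs_nablaM.
- exact: fs_nablaC. Qed.

End LogConnection.

(** * Operators with polynomial coefficients, and their action on [f^s] *)

Section PolynomialCoefficients.
Variables (k : fieldType) (n p : nat).
Implicit Types (P Q : diffop k n p) (u v : xfrac k n).

Lemma xpoly_subD u v : xpoly_sub u -> xpoly_sub v -> xpoly_sub (u + v).
Proof. by move=> [g ->] [h ->]; exists (g + h); rewrite tofracD. Qed.

Lemma xpoly_subM u v : xpoly_sub u -> xpoly_sub v -> xpoly_sub (u * v).
Proof. by move=> [g ->] [h ->]; exists (g * h); rewrite tofracM. Qed.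

Lemma xpoly_sub_fderiv i u : xpoly_sub u -> xpoly_sub (fderiv i u).
Proof. by move=> [g ->]; exists (g^`M(i)); rewrite fderiv_tofrac. Qed.

Lemma xpoly_sub0 : @xpoly_sub k n 0.
Proof. by exists 0; rewrite tofrac0. Qed.

Lemma xpoly_sub_sum I (s : seq I) (B : pred I) (G : I -> xfrac k n) :
  (forall i, B i -> xpoly_sub (G i)) -> xpoly_sub (\sum_(i <- s | B i) G i).
Proof.
by move=> sG; elim/big_ind: _ => //; [exact: xpoly_sub0 | exact: xpoly_subD].
Qed.

(** Left multiplication by [d_i] only shifts coefficients or differentiates them, and derivatives of
    polynomials are polynomials. *)
Lemma dop_over_dmul P Q :
  dop_over (@xpoly_sub k n) P -> dop_over (@xpoly_sub k n) Q ->
  dop_over (@xpoly_sub k n) (dmul (@sderiv k n p) P Q).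
Proof.
move=> sP sQ b c; rewrite /dmul /dapply !raddf_sum /=.
apply: xpoly_sub_sum => e _; rewrite mcoeffZ mcoeffM.
apply: xpoly_sub_sum => ? _; apply: xpoly_subM; first exact: sP.
set T := foldr _ _ _; suff : dop_over (@xpoly_sub k n) T by exact.
rewrite {}/T; elim: (enum _) => //= i s IH; elim: (e i) => //= m IHm b' c'.
rewrite mcoeffD mcoeff_map_zmod; last exact: sderivB.
rewrite mcoeffD mcoeff_sderiv; apply: xpoly_subD; last exact/xpoly_sub_fderiv/IHm.
(* The coefficient of [T * 'X_i] at [b'] is a shifted coefficient of [T] if [b'] involves [i], and
   zero otherwise. *)
have [bi|bi] := boolP (U_(i) <= b')%MM.
  by rewrite -(submK bi) addmC mcoeffMX; exact: IHm.
rewrite [_@_b']memN_msupp_eq0 ?mcoeff0; first exact: xpoly_sub0.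
rewrite (perm_mem (msuppMX _ _)); apply: contra bi => /mapP[e' _ ->].
exact: lem_addr.
Qed.

End PolynomialCoefficients.

Section FsAction.
Variables (k : fieldType) (n p : nat) (f : 'I_p -> {mpoly k[n]}).
Implicit Types (P Q : diffop k n p) (u : xsfrac k n p).

Lemma fs_actD P Q u : fs_act f (P + Q) u = fs_act f P u + fs_act f Q u.
Proof. exact: (@dapplyD _ n (xsfrac k n p)^o (fs_nabla f)). Qed.

Lemma fs_actB P Q u : fs_act f (P - Q) u = fs_act f P u - fs_act f Q u.
Proof. exact: (@dapplyB _ n (xsfrac k n p)^o (fs_nabla f)). Qed.

Lemma fs_actZ c P u : fs_act f (c *: P) u = c * fs_act f P u.
Proof. exact: (@dapplyZ _ n (xsfrac k n p)^o (fs_nabla f)). Qed.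

Lemma fs_actC c u : fs_act f c%:MP u = c * u.
Proof. exact: (@dapplyC _ n (xsfrac k n p)^o (fs_nabla f)). Qed.

End FsAction.

Lemma map_mpoly_scaled_comp (R S T : comNzRingType) (n : nat) (phi : {rmorphism S -> T})
    (d : R -> S) (dB : zmod_morphism d) h (b : {mpoly R[n]}) :
  map_mpoly phi (h *: map_mpoly d b) = (phi h)%:MP * map_mpoly (fun c => phi (d c)) b.
Proof.
apply/mpolyP => m; rewrite mcoeffCM !mcoeff_map_zmod
  ?mcoeffZ ?mcoeff_map_zmod ?rmorphM //.
- by move=> x y; rewrite dB rmorphB.
- exact: rmorphB.
Qed.

(** Used with [c = h], [d = h^-1] and [e = F^m]: the part [u] coming from the annihilator dies under
    [e], after which [h] is divided out. *)
Lemma scaled_cancel (R : comNzRingType) (p : nat) (c d e : R) (u v w : {mpoly R[p]}) :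
  d * c = 1 -> e *: u = e *: 0 -> c%:MP * v = u + w -> e *: v = e *: (d%:MP * w).
Proof.
move=> dc eu E; have -> : v = d%:MP * (u + w) by rewrite -E mulrA -mpolyCM dc mul1r.
by rewrite mulrDr scalerDr scalerAr eu scaler0 mulr0 add0r.
Qed.

(** * The local Bernstein-Sato ideal as a localization of [I2] *)

Section LocalBernsteinSato.
Variables (k : fieldType) (n p : nat) (f : 'I_p -> {mpoly k[n]}) (a : 'I_n -> k).
Implicit Types (h : {mpoly k[n]}) (P Q : diffop k n p) (b : {mpoly k[p]}).

(** The product of the denominators works: none vanishes at [a], so neither does the product. *)
Lemma local_sub_common_denom (s : seq (xfrac k n)) :
  (forall u, u \in s -> local_sub a u) ->
  exists2 h, h.@[a] != 0 & forall u, u \in s -> xpoly_sub (h%:F * u).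
Proof.
elim: s => [|u s IH] sloc; first by exists 1; rewrite ?meval1 ?oner_neq0.
have [v vs|h ha hs] := IH; first by apply: sloc; rewrite inE vs orbT.
have [g [d [da ->]]] := sloc u (mem_head _ _).
exists (h * d); first by rewrite mevalM mulf_neq0.
have dF : d%:F != 0 by rewrite tofrac_eq0; apply: contraNneq da => ->; rewrite meval0.
move=> v; rewrite inE tofracM => /orP[/eqP->|vs].
  by exists (h * g); rewrite tofracM mulrA -mulrA
    [_ / _]mulrC -!mulrA [d%:F * _]mulrA divff // mul1r.
rewrite [h%:F * _]mulrC -mulrA; apply: xpoly_subM (hs v vs).
by exists d.
Qed.

Lemma dop_common_denom P : dop_over (local_sub a) P ->
  exists2 h, h.@[a] != 0 & dop_over (@xpoly_sub k n) ((h%:F)%:MP *: P).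
Proof.
(* The list of all coefficients on the supports is finite; those off the supports are zero and need
   no denominator. *)
move=> Ploc; pose s := [seq (P@_e)@_c | e <- msupp P, c <- msupp P@_e].
have [u|h ha hs] := @local_sub_common_denom s.
  by case/allpairsPdep => b [c [_ _ ->]]; exact: Ploc.
exists h => // e c; rewrite mcoeffZ mcoeffCM.
have [->|c0] := eqVneq (P@_e)@_c 0; first by rewrite mulr0; exact: xpoly_sub0.
apply: hs; apply/allpairsPdep; exists e, c; split=> //.
  by rewrite mcoeff_msupp; apply: contraNneq c0 => ->; rewrite mcoeff0.
by rewrite mcoeff_msupp.
Qed.

Lemma map_mpoly_tofracZ h b :
  map_mpoly (@FracField.tofrac {mpoly k[n]}) (h *: map_mpoly (@mpolyC n k) b)
  = (h%:F)%:MP * map_mpoly (fun c : k => (c%:MP_[n])%:F) b.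
Proof. exact: (map_mpoly_scaled_comp (@FracField.tofrac {mpoly k[n]}) (@mpolyCB n k)). Qed.

Lemma dop_overC c : (forall m, xpoly_sub c@_m) ->
  dop_over (@xpoly_sub k n) (c%:MP : diffop k n p).
Proof.
move=> sc b m; rewrite mcoeffC; case: eqP => _; first by rewrite mulr1; exact: sc.
by rewrite mulr0 mcoeff0; exact: xpoly_sub0.
Qed.

Lemma local_BSP b :
  local_BS f a b <-> exists2 h, h.@[a] != 0 & I2 f (h *: map_mpoly (@mpolyC n k) b).
Proof.
set b' := map_mpoly (fun c : k => (c%:MP_[n])%:F) b.
split=> [[P /dop_common_denom[h ha sQ] [m Pb]]|[h ha [P [Q [[sP [m Pm]] sQ E]]]]].
  exists h => //; set Q := _ *: P in sQ.
  set FF : diffop k n p := (((Fprod f)%:F)%:MP)%:MP.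
  (* The element of [I1] is forced to be [h b - Q F], with [Q = h P] already polynomial. *)
  exists (((h%:F)%:MP * b')%:MP - dmul (@sderiv k n p) Q FF), Q; split => //; last first.
    by rewrite map_mpoly_tofracZ -/b' subrK.
  have sF : dop_over (@xpoly_sub k n) FF.
    apply: dop_overC => c; rewrite mcoeffC; case: eqP => _; rewrite ?mulr1 ?mulr0.
      by exists (Fprod f).
    exact: xpoly_sub0.
  split.
    move=> i c; rewrite !mcoeffB -mulN1r; apply: xpoly_subD.
      rewrite -map_mpoly_tofracZ; apply: dop_overC => e.
      by rewrite mcoeff_map_zmod; [eexists | exact: tofracB].
    apply: xpoly_subM; last exact: dop_over_dmul.
    by exists (-1); rewrite tofracN tofrac1.
  (* Applied to [f^s], this operator gives [h (b f^s - P F f^s)], which [F^m] kills by [Pb]. *)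
  exists m; rewrite fs_actB fs_actC fs_act_dmul fs_actC fs_actZ !mulr1.
  by rewrite -mulrBr scalerAr scalerBr -Pb subrr mulr0 scaler0.
have h0 : h != 0 by apply: contraNneq ha => ->; rewrite meval0.
have hF : h%:F != 0 by rewrite tofrac_eq0.
(* Dividing by [h] stays within local coefficients because [h] does not vanish at [a]. *)
exists (((h%:F)^-1)%:MP *: Q).
  move=> i c; rewrite mcoeffZ mcoeffCM; have [g ->] := sQ i c.
  by exists g, h; rewrite mulrC.
(* Both sides of [E] are applied to [f^s], which is represented by [1]. *)
exists m; rewrite fs_actZ -/b'; have := congr1 (fun T => fs_act f T 1) E.
rewrite map_mpoly_tofracZ fs_actC fs_actD fs_act_dmul fs_actC !mulr1 -/b'.
by move=> E1; apply: (scaled_cancel (mulVf hF) Pm E1).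
Qed.

End LocalBernsteinSato.

(** * Zariski closed sets and separation of points from them *)

Section ZariskiClosed.
Variables (k : fieldType) (n : nat).
Implicit Types (J : set {mpoly k[n]}) (S : set ('I_n -> k)) (a : 'I_n -> k).

(** The ideal exhibited for intersections and unions alike, in place of sums and products of
    ideals. *)
Definition vanishing_ideal S : set {mpoly k[n]} :=
  [set g | forall a, S a -> g.@[a] = 0].

Lemma vanishing_ideal_is_ideal S : is_ideal (vanishing_ideal S).
Proof.
split=> [a _|g h gS hS a Sa|g h hS a Sa]; first exact: meval0.
  by rewrite mevalD gS ?hS ?addr0.
by rewrite mevalM hS ?mulr0.
Qed.

Lemma not_zero_set J a : ~ zero_set J a -> exists2 g, J g & g.@[a] != 0.
Proof.
move=> nJ; apply: contrapT => nex; apply: nJ => g Jg.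
by apply: contrapT => /eqP ga; apply: nex; exists g.
Qed.

(** Indices outside [D] receive the function [1], and a product of values nonzero at [a] is nonzero.
    The product later serves as an equation of a union and as a denominator. *)
Lemma separating_functions (I : finType) (J : I -> set {mpoly k[n]}) (D : set I) a :
  (forall i, D i -> ~ zero_set (J i) a) ->
  exists g : I -> {mpoly k[n]},
    (forall i, D i -> J i (g i)) /\ (\prod_i g i).@[a] != 0.
Proof.
move=> sep.
have /boolp.choice[g gP] : forall i, exists g, (D i -> J i g) /\ g.@[a] != 0.
  move=> i; have [Di|nDi] := pselect (D i).
    by have [g Jg ga] := not_zero_set (sep i Di); exists g.
  by exists 1; rewrite meval1 oner_neq0.
exists g; split=> [i|]; first by have [] := gP i.
rewrite rmorph_prod /=; apply/prodf_neq0 => i _; by have [] := gP i.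
Qed.

Lemma zariski_closed_bigcap (I : Type) (J : I -> set {mpoly k[n]}) (D : set I) :
  zariski_closed (\bigcap_(i in D) zero_set (J i)).
Proof.
exists (vanishing_ideal (\bigcap_(i in D) zero_set (J i))).
  exact: vanishing_ideal_is_ideal.
apply/seteqP; split=> [a Sa g|a Va i Di g Jg]; first exact.
by apply: Va => c /(_ i Di); apply.
Qed.

(** For a point off the union, the product of separating functions vanishes on every member but not
    at that point. *)
Lemma zariski_closed_bigcup (I : finType) (J : I -> set {mpoly k[n]}) (D : set I) :
  (forall i, is_ideal (J i)) -> zariski_closed (\bigcup_(i in D) zero_set (J i)).
Proof.
move=> Jid; exists (vanishing_ideal (\bigcup_(i in D) zero_set (J i))).
  exact: vanishing_ideal_is_ideal.
apply/seteqP; split=> [a Sa g|a Va]; first exact.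
apply: contrapT => na; have [i Di Za|g [gJ]] := @separating_functions _ J D a.
  by apply: na; exists i.
rewrite Va ?eqxx // => c [i Di Zi]; rewrite (bigD1 i) //= mevalM.
by rewrite (Zi _ (gJ i Di)) mul0r.
Qed.

End ZariskiClosed.

(** * The strata, and localization of a primary decomposition at a point *)

Section Strata.
Variables (k : fieldType) (n p r : nat) (U : 'I_r -> set {mpoly {mpoly k[n]}[p]}).
Implicit Types (sigma : {set 'I_r}) (a : 'I_n -> k) (b : {mpoly {mpoly k[n]}[p]}).

Lemma contract_x_ideal (I : set {mpoly {mpoly k[n]}[p]}) :
  is_ideal I -> is_ideal (contract_x I).
Proof.
case=> I0 ID IM; split=> [|g h Ig Ih|g h Ih]; rewrite /contract_x /=.
- by rewrite mpolyC0.
- by rewrite mpolyCD; exact: ID.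
- by rewrite mpolyCM; exact: IM.
Qed.

(** In this form [sigma] is determined by [a], which yields disjointness and covering. *)
Lemma stratumP sigma a :
  stratum U sigma a <-> forall i, zero_set (contract_x (U i)) a <-> i \in sigma.
Proof.
split=> [[inZ outZ] i|H].
  split=> [Zi|]; last exact: inZ.
  by apply: contrapT => /negP ni; apply: outZ; exists i.
by split=> [i /H //|[i /= /negP ni /H]].
Qed.

Hypothesis U_primary : forall i, is_primary (U i).

Lemma strata_constructible_stratification :
  constructible_stratification (stratum U).
Proof.
split=> [sigma|s t st|].
- exists 1%N, (fun=> \bigcap_(i in [set i | i \in sigma]) zero_set (contract_x (U i))),
    (fun=> \bigcup_(i in [set i | i \notin sigma]) zero_set (contract_x (U i))).
  split=> [_|_|]; first exact: zariski_closed_bigcap.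
    by apply: zariski_closed_bigcup => i; apply: contract_x_ideal; case: (U_primary i).
  by apply/seteqP; split=> [a Sa|a [_ _]]; [exists ord0 | exact].
- apply/seteqP; split=> // a [/stratumP sa /stratumP ta]; case/eqP: st.
  by apply/setP => i; apply/idP/idP => [/sa/ta|/ta/sa].
- apply/seteqP; split=> // a _.
  exists [set i | `[< zero_set (contract_x (U i)) a >]]%SET => //.
  by apply/stratumP => i; rewrite finset.in_set; split=> /asboolP.
Qed.

Lemma primary_localization a b :
  (exists2 h : {mpoly k[n]}, h.@[a] != 0 & (\bigcap_i U i) (h *: b)) <->
  (forall i, zero_set (contract_x (U i)) a -> U i b).
Proof.
split=> [[h ha hb] i Zi|Ub].
  have [_ _ prim] := U_primary i; have := hb i I.
  (* [is_primary] puts the power on the second factor, hence the swap. A power of [h] in [U i] would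
     have to vanish at [a], contrary to [ha]. *)
  rewrite -mul_mpolyC mulrC => /prim[//|[m Uhm]].
  have : (h ^+ m).@[a] = 0 by apply: Zi; rewrite /contract_x /= rmorphXn.
  by rewrite rmorphXn => /eqP; rewrite expf_eq0 (negbTE ha) andbF.
(* Components whose contraction does not vanish at [a] absorb the multiplier, having [g i] as a
   factor; the others already contain [b]. *)
have [//|g [gJ ga]] := @separating_functions k n _ (fun i => contract_x (U i))
  [set i | ~ zero_set (contract_x (U i)) a] a.
exists (\prod_i g i) => // i _; have [[_ _ UM] _ _] := U_primary i.
rewrite -mul_mpolyC; have [Zi|nZi] := pselect (zero_set (contract_x (U i)) a).
  exact/UM/Ub.
by rewrite (bigD1 i) //= mulrC mpolyCM [_%:MP * _]mulrC mulrA; apply/UM/gJ.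
Qed.

End Strata.

(** * Constancy of the local ideal along the strata *)

Theorem corollary1p5 (k : fieldType) (hk : [pchar k]%R =i pred0)
    (n p : nat) (hn : (0 < n)%N) (hp : (0 < p)%N)
    (f : 'I_p -> {mpoly k[n]})
    (r : nat) (Upsilon : 'I_r -> set {mpoly {mpoly k[n]}[p]})
    (hU : primary_decomposition (I2 f) Upsilon) :
  constructible_stratification (stratum Upsilon) /\
  (forall (sigma : {set 'I_r}) (a b : 'I_n -> k),
     stratum Upsilon sigma a -> stratum Upsilon sigma b ->
     local_BS f a = local_BS f b).
Proof.
have [Uprim UI] := hU; split; first exact: strata_constructible_stratification.
(* The right-hand condition depends on [sigma] but not on the point [a], so two points of one
   stratum have the same local ideal. *)
have BSP sigma a c : stratum Upsilon sigma a ->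
    (local_BS f a c <-> forall i, i \in sigma -> Upsilon i (map_mpoly (@mpolyC n k) c)).
  move=> /stratumP sa; rewrite local_BSP UI primary_localization //.
  by split=> H i /sa; exact: H.
move=> sigma a b sa sb; apply/seteqP; split=> c.
  by move=> /(BSP _ _ _ sa)/(BSP _ _ _ sb).
by move=> /(BSP _ _ _ sb)/(BSP _ _ _ sa).
Qed.
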